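(* Let $N$ be a homogeneous norm on $\mathbb{H}^n$ and let $\|z\|:=N((z,0))$ for $z\in\mathbb{R}^{2n}$. Denote by $d_{SF}$ the sub-Finsler distance on $\mathbb{H}^n$ associated to $\|\cdot\|$. If $(\mathbb{H}^n,d_{SF})$ has the geodesic linearity property, then so does $(\mathbb{H}^n,d_N)$.
   Context: For $n\geq 1$, the Heisenberg group $\mathbb{H}^n$ is the set $\mathbb{R}^{2n}\times\mathbb{R}$ with group law $(z,t)\ast(z',t')=(z+z',\,t+t'+2\omega_n(z,z'))$, where $\omega_n(z,z')=\langle z,J_nz'\rangle$, $J_n=\begin{pmatrix}0&-E_n\\ E_n&0\end{pmatrix}$ and $E_n$ is the $n\times n$ identity matrix. The neutral element is $e=(0,0)$ and $(z,t)^{-1}=(-z,-t)$. For $\lambda>0$ the dilation is $\delta_\lambda(z,t)=(\lambda z,\lambda^2t)$. A homogeneous norm on $\mathbb{H}^n$ is a function $N:\mathbb{H}^n\to[0,\infty)$ with $N(p)=0\Leftrightarrow p=e$, $N(p^{-1})=N(p)$, $N(p\ast q)\leq N(p)+N(q)$ and $N(\delta_\lambda(p))=\lambda N(p)$ for all $p,q\in\mathbb{H}^n$, $\lambda>0$. It induces the homogeneous distance $d_N(p,q)=N(p^{-1}\ast q)$. The function $z\mapsto N((z,0))$ is always a norm on $\mathbb{R}^{2n}$. A horizontal curve in $\mathbb{H}^n$ is a curve $\gamma=(\gamma_1,\dots,\gamma_{2n+1}):[a,b]\to\mathbb{R}^{2n+1}$, absolutely continuous in the Euclidean sense, with $\dot\gamma_{2n+1}(s)=2\sum_{i=1}^n\left(\dot\gamma_i(s)\gamma_{n+i}(s)-\dot\gamma_{n+i}(s)\gamma_i(s)\right)$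 for almost every $s\in[a,b]$; write $\gamma_I=(\gamma_1,\dots,\gamma_{2n})$. The sub-Finsler distance associated to a norm $\|\cdot\|$ on $\mathbb{R}^{2n}$ is $d_{SF}(p,q)=\inf_\gamma\int_a^b\|\dot\gamma_I(s)\|\,\mathrm{d}s$, the infimum taken over all horizontal curves $\gamma:[a,b]\to\mathbb{H}^n$ with $\gamma(a)=p$, $\gamma(b)=q$; it is a left-invariant homogeneous distance on $\mathbb{H}^n$. For a homogeneous distance $d$ on $\mathbb{H}^n$, $(\mathbb{H}^n,d)$ has the geodesic linearity property if for every map $\gamma:\mathbb{R}\to\mathbb{H}^n$ with $d(\gamma(s_1),\gamma(s_2))=|s_1-s_2|$ for all $s_1,s_2\in\mathbb{R}$ there exists $z_0\in\mathbb{R}^{2n}\setminus\{0\}$ such that $\gamma(s)=\gamma(0)\ast(sz_0,0)$ for all $s\in\mathbb{R}$. *)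

(* Defs.v *)
From mathcomp Require Import all_boot all_order all_algebra.
From mathcomp Require Import all_classical all_reals all_analysis.

Set Implicit Arguments.
Unset Strict Implicit.
Unset Printing Implicit Defensive.

Import Order.TTheory GRing.Theory Num.Theory.
Import numFieldNormedType.Exports.

Local Open Scope classical_set_scope.
Local Open Scope ring_scope.

(* R^{2n} is 'cV[R]_(n + n): the coordinate z_i, 1 <= i <= n, is the entry at
   lshift n i and z_{n+i} is the entry at rshift n i. *)
Definition heis (R : realType) (n : nat) : Type := ('cV[R]_(n + n) * R)%type.

Definition Jmx (R : realType) (n : nat) : 'M[R]_(n + n) :=
  block_mx 0 (- 1%:M) 1%:M 0.

Definition dotv (R : realType) (m : nat) (z w : 'cV[R]_m) : R :=
  \sum_i z i 0 * w i 0.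

Definition omega (R : realType) (n : nat) (z w : 'cV[R]_(n + n)) : R :=
  dotv z (Jmx R n *m w).

Definition hmul (R : realType) (n : nat) (p q : heis R n) : heis R n :=
  (p.1 + q.1, p.2 + q.2 + 2 * omega p.1 q.1).

Definition hone (R : realType) (n : nat) : heis R n := (0, 0).

Definition hinv (R : realType) (n : nat) (p : heis R n) : heis R n :=
  (- p.1, - p.2).

Definition hdil (R : realType) (n : nat) (l : R) (p : heis R n) : heis R n :=
  (l *: p.1, l ^+ 2 * p.2).

Record homogeneous_norm (R : realType) (n : nat) (N : heis R n -> R) : Prop :=
  HomogeneousNorm {
    hnorm_ge0 : forall p, 0 <= N p;
    hnorm_eq0 : forall p, N p = 0 <-> p = hone R n;
    hnorm_inv : forall p, N (hinv p) = N p;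
    hnorm_mul : forall p q, N (hmul p q) <= N p + N q;
    hnorm_dil : forall (l : R) p, 0 < l -> N (hdil l p) = l * N p
  }.

Definition hdist (R : realType) (n : nat) (N : heis R n -> R)
  (p q : heis R n) : R := N (hmul (hinv p) q).

Definition eucl_dist (R : realType) (n : nat) (p q : heis R n) : R :=
  Num.sqrt (dotv (p.1 - q.1) (p.1 - q.1) + (p.2 - q.2) ^+ 2).

(* Curves on [a, b] are functions on R of which only the restriction to [a, b]
   is ever used, up to null sets. The subintervals ]u_i, v_i[ may be empty. *)
Definition abs_continuous (R : realType) (n : nat) (a b : R)
    (g : R -> heis R n) : Prop :=
  forall e : R, 0 < e -> exists2 d : R, 0 < d &
    forall (m : nat) (u v : 'I_m -> R),
      (forall i, [/\ a <= u i, u i <= v i & v i <= b]) ->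
      trivIset setT (fun i => [set` `]u i, v i[]) ->
      \sum_i (v i - u i) < d ->
      \sum_i eucl_dist (g (u i)) (g (v i)) < e.

Definition hcoord (R : realType) (n : nat) (g : R -> heis R n)
  (i : 'I_(n + n)) : R -> R := fun s => (g s).1 i 0.

Definition vcoord (R : realType) (n : nat) (g : R -> heis R n) : R -> R :=
  fun s => (g s).2.

Definition hvelocity (R : realType) (n : nat) (g : R -> heis R n) (s : R) :
  'cV[R]_(n + n) := \col_i derive1 (hcoord g i) s.

(* The derivability clauses hold for almost every s as soon as g is absolutely
   continuous; they are there because derive1 is a total function. *)
Definition horizontal (R : realType) (n : nat) (a b : R)
    (g : R -> heis R n) : Prop :=
  abs_continuous a b g /\
  {ae @lebesgue_measure R, forall s : R, a <= s <= b ->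
    [/\ forall i, derivable (hcoord g i) s 1,
        derivable (vcoord g) s 1 &
        derive1 (vcoord g) s =
          2 * \sum_(i < n)
            (derive1 (hcoord g (lshift n i)) s * hcoord g (rshift n i) s
           - derive1 (hcoord g (rshift n i)) s * hcoord g (lshift n i) s)]}.

Definition sf_length (R : realType) (n : nat) (nrm : 'cV[R]_(n + n) -> R)
    (a b : R) (g : R -> heis R n) : \bar R :=
  (\int[@lebesgue_measure R]_(s in [set` `[a, b]]) (nrm (hvelocity g s))%:E)%E.

(* When nrm is a norm the infimum is finite, since any two points are joined by
   a horizontal curve of finite length; fine only changes its type. *)
Definition sf_dist (R : realType) (n : nat) (nrm : 'cV[R]_(n + n) -> R)
    (p q : heis R n) : R :=
  fine (ereal_inf [set l : \bar R | exists (a b : R) (g : R -> heis R n),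
    [/\ a <= b, horizontal a b g, g a = p, g b = q & l = sf_length nrm a b g]]).

Definition geodesic_linearity (R : realType) (n : nat)
    (d : heis R n -> heis R n -> R) : Prop :=
  forall g : R -> heis R n,
    (forall s1 s2 : R, d (g s1) (g s2) = `|s1 - s2|) ->
    exists z0 : 'cV[R]_(n + n), z0 != 0 /\
      forall s : R, g s = hmul (g 0) (s *: z0, 0).

(* Main.v *)
Require Import Defs.
From mathcomp Require Import all_boot all_order all_algebra.
From mathcomp Require Import all_classical all_reals all_analysis.
From mathcomp Require Import measurable_realfun ring lra.
Import Order.TTheory GRing.Theory Num.Theory.
Import numFieldNormedType.Exports.
Local Open Scope ring_scope.

(** A geodesic [g] of the homogeneous distance is also a geodesic of the sub-Finsler
    distance, that is, [sf_dist (g s1) (g s2) = |s1 - s2|] for all [s1] and [s2]; the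
    hypothesis on the sub-Finsler distance then applies to [g] itself. Both
    inequalities come from the same decomposition. Cut a curve into a chain of
    points with steps [(z_k, tau_k)]. Vertical elements are central, so the end
    of the chain is the end of the horizontal polygon with sides [z_k], times
    the vertical element [(0, sum tau_k)] ([develop_correct]). When the chain is
    refined, the sum of the areas [tau_k] tends to [0].

    Upper bound ([geodesic_sf_short]). For a chain of steps of norm [h] on [g], each
    side has [N (z_k, 0) <= h] ([hnorm_horizontal_le]) and each area is of order
    [h ^ 2] ([vertical_le_hnorm]). The polygon is therefore no longer than
    [|s1 - s2|], it ends close to [g s2], and a short parallelogram closes the gap
    ([vertical_bend]). Polygons are admissible curves ([polygon_horizontal]).

    Lower bound ([hdist_le_sf_length]). The homogeneous distance of the end points of
    any horizontal curve is at most its length. For a fine chain on the curve,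
    the sides add up to at most the length by the mean value inequality
    ([displacement_le]). The area of a step is at most a multiple of the
    oscillation over that step times its length ([area_le]), because [omega] is
    bounded by the norm itself: [|omega z w| <= C N (z, 0) N (w, 0)] ([omega_le]).
    Both estimates are instances of one lemma on absolutely continuous interval
    functions ([subadditive_le_increment]), applied with the primitive of the speed,
    which has the speed as its derivative almost everywhere. *)

(** * The Heisenberg group *)

Section HeisenbergGroup.
Context {R : realType} {n : nat}.
Implicit Types (z w : 'cV[R]_(n + n)) (p q r : heis R n).

Lemma omegaE z w : omega z w =
  \sum_(i < n) (w (lshift n i) 0 * z (rshift n i) 0
              - w (rshift n i) 0 * z (lshift n i) 0).
Proof.
rewrite /omega /dotv big_split_ord /= addrC -big_split /=; apply: eq_bigr => i _.
have -> : Jmx R n *m w = col_mx (- dsubmx w) (usubmx w).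
  rewrite -[in LHS](vsubmxK w) /Jmx mul_block_col.
  by rewrite !mul0mx mulNmx !mul1mx add0r addr0.
by rewrite col_mxEd col_mxEu !mxE; ring.
Qed.

Lemma omegaDl z1 z2 w : omega (z1 + z2) w = omega z1 w + omega z2 w.
Proof.
by rewrite !omegaE -big_split; apply: eq_bigr => i _; rewrite !mxE /=; ring.
Qed.

Lemma omegaZl a z w : omega (a *: z) w = a * omega z w.
Proof.
by rewrite !omegaE mulr_sumr; apply: eq_bigr => i _; rewrite !mxE /=; ring.
Qed.

Lemma omegaC z w : omega z w = - omega w z.
Proof. by rewrite !omegaE -sumrN; apply: eq_bigr => i _; ring. Qed.

Lemma omegaDr z w1 w2 : omega z (w1 + w2) = omega z w1 + omega z w2.
Proof. by rewrite !(omegaC z) omegaDl opprD. Qed.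

Lemma omegaZr a z w : omega z (a *: w) = a * omega z w.
Proof. by rewrite !(omegaC z) omegaZl mulrN. Qed.

Lemma omegaNl z w : omega (- z) w = - omega z w.
Proof. by rewrite -scaleN1r omegaZl mulN1r. Qed.

Lemma omegaNr z w : omega z (- w) = - omega z w.
Proof. by rewrite -scaleN1r omegaZr mulN1r. Qed.

Lemma omega_diag z : omega z z = 0.
Proof. by have := omegaC z z; lra. Qed.

Lemma omega0l w : omega 0 w = 0.
Proof. by rewrite -[0](scale0r (0 : 'cV[R]_(n+n))) omegaZl mul0r. Qed.

Lemma omega0r z : omega z 0 = 0.
Proof. by rewrite omegaC omega0l oppr0. Qed.

Definition omega_bilE := (omegaDl, omegaDr, omegaNl, omegaNr, omegaZl, omegaZr,
  omega0l, omega0r, omega_diag).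

Lemma hmulA p q r : hmul p (hmul q r) = hmul (hmul p q) r.
Proof.
by rewrite /hmul /= !omega_bilE addrA; congr pair; ring.
Qed.

Lemma hmul0r p : hmul p (0, 0) = p.
Proof. by case: p => z t; rewrite /hmul /= omega0r !addr0 mulr0 addr0. Qed.

(** Up to a constant factor this is the symplectic area enclosed by the chord from
    [p.1] to [q.1] and the projection of any horizontal curve from [p] to [q]; it
    vanishes exactly when [q] is reached from [p] along a horizontal line. *)
Definition area p q : R := (hmul (hinv p) q).2.

Lemma areaE p q : area p q = q.2 - p.2 - 2 * omega p.1 (q.1 - p.1).
Proof. by rewrite /area /hmul /= !omega_bilE; ring. Qed.

Lemma hmulVE p q : hmul (hinv p) q = (q.1 - p.1, area p q).
Proof. by rewrite /area /hmul /= addrC. Qed.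

(** The four sides of this closed parallelogram do not close up in the group:
    they rise by [4 * omega z w], which makes every vertical displacement
    reachable by horizontal steps. *)
Definition bend z w := hmul (hmul (hmul (z, 0) (w, 0)) (- z, 0)) (- w, 0) : heis R n.

Lemma bendE z w : bend z w = (0, 4 * omega z w).
Proof.
rewrite /bend /hmul /= !omega_bilE (omegaC w z); congr pair; last by ring.
by rewrite [z + w]addrC addrK subrr.
Qed.

End HeisenbergGroup.

(** * Homogeneous norms *)

Section HomogeneousNorm.
Context {R : realType} {n : nat} {N : heis R n -> R}.
Hypothesis hN : homogeneous_norm N.
Implicit Types (z w : 'cV[R]_(n + n)) (p q : heis R n).

Lemma hnorm0 : N (0, 0) = 0.
Proof. exact/(hnorm_eq0 hN). Qed.

Lemma hnorm_opp z : N (- z, 0) = N (z, 0).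
Proof. by rewrite -[RHS](hnorm_inv hN) /hinv /= oppr0. Qed.

Lemma hnorm_vertical_gt0 : 0 < N (0, 1).
Proof.
rewrite lt_neqAle (hnorm_ge0 hN) andbT eq_sym; apply/eqP => /(hnorm_eq0 hN).
by case=> /eqP; rewrite oner_eq0.
Qed.

Lemma hnorm_vertical t : N (0, t) = Num.sqrt `|t| * N (0, 1).
Proof.
have pos s : 0 < s -> N (0, s) = Num.sqrt `|s| * N (0, 1).
  move=> s0; rewrite -(hnorm_dil hN) ?sqrtr_gt0 ?normr_gt0 ?gt_eqF//.
  by rewrite /hdil /= scaler0 sqr_sqrtr ?normr_ge0// gtr0_norm// mulr1.
case: (ltgtP t 0) => [t0|t0|->]; [|exact: pos|].
- by rewrite -(hnorm_inv hN) /hinv /= oppr0 pos ?oppr_gt0// normrN.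
- by rewrite normr0 sqrtr0 mul0r hnorm0.
Qed.

Lemma hnorm_scale l z : N (l *: z, 0) = `|l| * N (z, 0).
Proof.
have pos m : 0 < m -> N (m *: z, 0) = `|m| * N (z, 0).
  by move=> m0; rewrite gtr0_norm// -(hnorm_dil hN)// /hdil /= mulr0.
case: (ltgtP l 0) => [l0|l0|->]; [|exact: pos|].
- by rewrite -(hnorm_opp (l *: z)) -scaleNr pos ?oppr_gt0// normrN.
- by rewrite scale0r normr0 mul0r hnorm0.
Qed.

(** The powers [(z, t) ^ k = (k z, k t)] have norm at most [k N (z, t)];
    dilating back by [1/k] makes the vertical part vanish in the limit. *)
Lemma hnorm_horizontal_le z t : N (z, 0) <= N (z, t).
Proof.
pose pw k : heis R n := (k%:R *: z, k%:R * t).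
have pwS k : pw k.+1 = hmul (pw k) (z, t).
  rewrite /pw /hmul /= !omega_bilE !mulr0 addr0 -(addn1 k) natrD scalerDl scale1r.
  by congr pair; ring.
have pw_le k : N (pw k) <= k%:R * N (z, t).
  elim: k => [|k IH]; first by rewrite /pw scale0r !mul0r hnorm0.
  rewrite pwS (le_trans (hnorm_mul hN _ _))// -(addn1 k) natrD mulrDl mul1r.
  by rewrite lerD2r.
have le k : (0 < k)%N -> N (z, 0) <= N (z, t) + Num.sqrt (`|t| / k%:R) * N (0, 1).
  move=> k0; have k0' : 0 < k%:R :> R by rewrite ltr0n.
  have -> : (z, 0) = hmul (z, t / k%:R) (0, - (t / k%:R)) :> heis R n.
    by rewrite /hmul /= omega0r mulr0 !addr0 subrr.
  rewrite (le_trans (hnorm_mul hN _ _))// lerD//.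
    have -> : (z, t / k%:R) = hdil k%:R^-1 (pw k).
      rewrite /hdil /pw /= scalerA mulVf ?gt_eqF// scale1r; congr pair.
      by field; rewrite gt_eqF.
    rewrite (hnorm_dil hN) ?invr_gt0// mulrC ler_pdivrMr//.
    by rewrite mulrC pw_le.
  by rewrite hnorm_vertical normrN normrM normfV (gtr0_norm k0').
apply/ler_addgt0Pr => e e0.
(* [k > c] is what makes [sqrt (|t| / k) * N (0, 1)] smaller than [e] *)
pose c := N (0, 1) ^+ 2 * `|t| / e ^+ 2.
have c0 : 0 <= c by rewrite divr_ge0 ?sqr_ge0// mulr_ge0 ?sqr_ge0.
have [k kc] : exists k : nat, c < k.+1%:R.
  by exists (Num.trunc c); rewrite -truncn_lt_nat.
apply: le_trans (le k.+1 isT) _; rewrite lerD2l.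
rewrite -ler_pdivlMr ?hnorm_vertical_gt0//.
rewrite -[leRHS]ger0_norm ?divr_ge0 ?(ltW e0) ?(hnorm_ge0 hN)//.
rewrite -(sqrtr_sqr (e / N (0, 1))) ler_sqrt ?sqr_ge0// ler_pdivrMr// ?ltr0n//.
have N1 := hnorm_vertical_gt0.
have -> : `|t| = (e / N (0, 1)) ^+ 2 * c.
  by rewrite /c; field; rewrite !gt_eqF.
by rewrite ler_wpM2l ?sqr_ge0// ltW.
Qed.

Lemma hnorm_triangle z w : N (z + w, 0) <= N (z, 0) + N (w, 0).
Proof.
apply: le_trans (hnorm_mul hN (z, 0) (w, 0)).
exact: hnorm_horizontal_le.
Qed.

Lemma hnorm_vertical_sq t : N (0, t) ^+ 2 = `|t| * N (0, 1) ^+ 2.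
Proof. by rewrite hnorm_vertical exprMn sqr_sqrtr. Qed.

(** The vertical part of an element of norm [h] is of order [h ^ 2]. This
    quadratic rate is what makes the areas of a fine chain sum up to almost
    nothing. *)
Lemma vertical_le_hnorm z t : `|t| * N (0, 1) ^+ 2 <= 4 * N (z, t) ^+ 2.
Proof.
have -> : 4 * N (z, t) ^+ 2 = (2 * N (z, t)) ^+ 2 by ring.
rewrite -hnorm_vertical_sq ler_sqr ?nnegrE ?mulr_ge0 ?(hnorm_ge0 hN)//.
have -> : (0, t) = hmul (z, t) (- z, 0).
  by rewrite /hmul /= !omega_bilE subrr oppr0 mulr0 !addr0.
apply: le_trans (hnorm_mul hN _ _) _.
by rewrite hnorm_opp; have := hnorm_horizontal_le z t; lra.
Qed.

(** The commutator of [(z, 0)] and [(w, 0)] is [(0, 4 omega z w)], which bounds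
    [omega z w] by the square of [N (z, 0) + N (w, 0)]; rescaling [z] and [w] by
    inverse factors turns that square into the product. *)
Lemma omega_le z w : `|omega z w| * N (0, 1) ^+ 2 <= 4 * (N (z, 0) * N (w, 0)).
Proof.
have sum_le x y : `|omega x y| * N (0, 1) ^+ 2 <= (N (x, 0) + N (y, 0)) ^+ 2.
  have : N (bend x y) <= 2 * (N (x, 0) + N (y, 0)).
    have h1 := hnorm_mul hN (x, 0) (y, 0).
    have h2 := hnorm_mul hN (hmul (x, 0) (y, 0)) (- x, 0).
    have h3 := hnorm_mul hN (hmul (hmul (x, 0) (y, 0)) (- x, 0)) (- y, 0).
    by move: h2 h3; rewrite /bend !hnorm_opp; lra.
  rewrite bendE -ler_sqr ?nnegrE ?mulr_ge0 ?addr_ge0 ?(hnorm_ge0 hN)//.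
  rewrite hnorm_vertical_sq normrM (ger0_norm (_ : 0 <= 4))// => h.
  by rewrite -(ler_pM2l (_ : 0 < 4))// mulrA (le_trans h)// exprMn; lra.
have scaled_le l : 0 < l ->
    `|omega z w| * N (0, 1) ^+ 2 <= (l * N (z, 0) + l^-1 * N (w, 0)) ^+ 2.
  move=> l0; have := sum_le (l *: z) (l^-1 *: w).
  rewrite !hnorm_scale normfV (gtr0_norm l0) omegaZl omegaZr mulrA.
  by rewrite divff ?gt_eqF// mul1r.
have [z0|zN0] := eqVneq (N (z, 0)) 0.
  have [-> _] : z = 0 /\ true by move/(hnorm_eq0 hN): z0 => [->].
  by rewrite omega0l normr0 mul0r hnorm0 mul0r mulr0.
have [w0|wN0] := eqVneq (N (w, 0)) 0.
  have [-> _] : w = 0 /\ true by move/(hnorm_eq0 hN): w0 => [->].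
  by rewrite omega0r normr0 mul0r hnorm0 !mulr0.
have zp : 0 < N (z, 0) by rewrite lt_neqAle eq_sym zN0 (hnorm_ge0 hN).
have wp : 0 < N (w, 0) by rewrite lt_neqAle eq_sym wN0 (hnorm_ge0 hN).
(* the factor that makes the two summands equal *)
pose l := Num.sqrt (N (w, 0) / N (z, 0)).
have l0 : 0 < l by rewrite sqrtr_gt0 divr_gt0.
have l2 : l ^+ 2 = N (w, 0) / N (z, 0) by rewrite sqr_sqrtr// divr_ge0// ltW.
apply: le_trans (scaled_le l l0) _.
have -> : l^-1 * N (w, 0) = l * N (z, 0).
  have -> : N (w, 0) = l ^+ 2 * N (z, 0) by rewrite l2 divfK.
  by field; rewrite gt_eqF.
have -> : (l * N (z, 0) + l * N (z, 0)) ^+ 2 = 4 * (l ^+ 2 * N (z, 0) ^+ 2) by ring.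
by rewrite l2 le_eqVlt; apply/orP; left; apply/eqP; field.
Qed.

(** A Lipschitz constant of the norm [z |-> N (z, 0)] with respect to the sup
    norm of the coordinates. *)
Definition norm_bound := \sum_i N (delta_mx i 0, 0).

Lemma norm_bound_ge0 : 0 <= norm_bound.
Proof. by apply: sumr_ge0 => i _; exact: hnorm_ge0. Qed.

Lemma hnorm_le_sum z : N (z, 0) <= \sum_i `|z i 0| * N (delta_mx i 0, 0).
Proof.
have {1}-> : z = \sum_i z i 0 *: delta_mx i 0.
  apply/matrixP => i j; rewrite (ord1 j) summxE (bigD1 i)//= !mxE !eqxx mulr1.
  by rewrite big1 ?addr0// => k ki; rewrite !mxE eq_sym (negbTE ki) mulr0.
elim/big_rec2 : _ => [|i x y _ h]; first by rewrite hnorm0.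
by rewrite (le_trans (hnorm_triangle _ _))// hnorm_scale lerD2l.
Qed.

Lemma hnorm_le_bound z e : (forall i, `|z i 0| <= e) -> N (z, 0) <= norm_bound * e.
Proof.
move=> h; apply: le_trans (hnorm_le_sum z) _; rewrite /norm_bound mulr_suml.
by apply: ler_sum => i _; rewrite mulrC ler_wpM2l ?(hnorm_ge0 hN).
Qed.

Lemma dotvv_ge0 z : 0 <= dotv z z.
Proof. by apply: sumr_ge0 => i _; rewrite -expr2 sqr_ge0. Qed.

Lemma coord_le_eucl p q i : `|(p.1 - q.1) i 0| <= eucl_dist p q.
Proof.
rewrite /eucl_dist -sqrtr_sqr ler_sqrt ?addr_ge0 ?sqr_ge0 ?dotvv_ge0//.
rewrite /dotv (bigD1 i)//= -expr2 -addrA lerDl addr_ge0 ?sqr_ge0//.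
by apply: sumr_ge0 => k _; rewrite -expr2 sqr_ge0.
Qed.

Lemma vert_le_eucl p q : `|p.2 - q.2| <= eucl_dist p q.
Proof.
rewrite /eucl_dist -sqrtr_sqr ler_sqrt ?addr_ge0 ?sqr_ge0 ?dotvv_ge0//.
by rewrite lerDr dotvv_ge0.
Qed.

Lemma hnorm_le_eucl p q : N (p.1 - q.1, 0) <= norm_bound * eucl_dist p q.
Proof. by apply: hnorm_le_bound => i; exact: coord_le_eucl. Qed.

End HomogeneousNorm.

(** * Chains of points and their horizontal development *)

Section Chain.
Context {R : realType} {n : nat}.
Implicit Types z : 'cV[R]_(n + n).

Definition chain_area (p : nat -> heis R n) k : R :=
  \sum_(i < k) area (p i) (p i.+1).

(** The chain that starts at [p 0] and makes only the horizontal parts of the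
    steps of [p]. The vertical parts are central, so all that the development
    misses is their sum; hence this closed form. *)
Definition develop (p : nat -> heis R n) k : heis R n :=
  ((p k).1, (p k).2 - chain_area p k).

Lemma develop0 p : develop p 0 = p 0.
Proof. by rewrite /develop /chain_area big_ord0 subr0; case: (p 0). Qed.

Lemma developS p k :
  develop p k.+1 = hmul (develop p k) ((p k.+1).1 - (p k).1, 0).
Proof.
rewrite /develop /hmul /= [(p k).1 + _]addrC subrK; congr pair.
by rewrite /chain_area big_ord_recr /= areaE; ring.
Qed.

Lemma develop_correct p k : hmul (develop p k) (0, chain_area p k) = p k.
Proof.
rewrite /develop /hmul /= omega0r mulr0 !addr0 subrK.
by case: (p k).
Qed.

Definition polygon p zs := foldl (fun q z => hmul q (z, 0)) p zs : heis R n.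

Lemma develop_polygon p k :
  develop p k = polygon (p 0) [seq (p i.+1).1 - (p i).1 | i <- iota 0 k].
Proof.
elim: k => [|k IH]; first exact: develop0.
rewrite developS -[X in iota 0 X]addn1 iotaD map_cat /polygon foldl_cat /=.
by rewrite -/(polygon _ _) -IH.
Qed.

Context {N : heis R n -> R}.
Hypothesis hN : homogeneous_norm N.

(** The development is reached by horizontal steps, and one vertical step leads
    from its end to [p k]. *)
Lemma hnorm_chain_le p k : N (hmul (hinv (p 0)) (p k)) <=
  \sum_(i < k) N ((p i.+1).1 - (p i).1, 0) + N (0, chain_area p k).
Proof.
rewrite -[X in hmul _ X](develop_correct p k) hmulA.
apply: le_trans (hnorm_mul hN _ _) _; rewrite lerD2r.
elim: k => [|k IH].
  by rewrite develop0 big_ord0 hmulVE areaE !subrr omega0r mulr0 subr0 hnorm0.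
rewrite developS hmulA big_ord_recr /=.
by apply: le_trans (hnorm_mul hN _ _) _; rewrite lerD2r.
Qed.

End Chain.

(** * Polygons are horizontal curves *)

Section Polygons.
Context {R : realType} {n : nat}.
Implicit Types (z w : 'cV[R]_(n + n)) (p q : heis R n) (g h : R -> heis R n).
Notation mu := (@lebesgue_measure R).

Definition horizontal_at g s :=
  [/\ forall i, derivable (hcoord g i) s 1,
      derivable (vcoord g) s 1 &
      derive1 (vcoord g) s =
        2 * \sum_(i < n)
          (derive1 (hcoord g (lshift n i)) s * hcoord g (rshift n i) s
         - derive1 (hcoord g (rshift n i)) s * hcoord g (lshift n i) s)].

(** The right-hand side of the horizontality equation is the vertical velocity of
    the horizontal line through [g s] in the direction [hvelocity g s]. *)
Lemma horizontal_eq_omega g s :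
  2 * \sum_(i < n)
          (derive1 (hcoord g (lshift n i)) s * hcoord g (rshift n i) s
         - derive1 (hcoord g (rshift n i)) s * hcoord g (lshift n i) s) =
  2 * omega (g s).1 (hvelocity g s).
Proof.
by congr (2 * _); rewrite omegaE; apply: eq_bigr => i _; rewrite !mxE.
Qed.

Lemma near_hcoord g h (s : R) i : {near s, g =1 h} -> {near s, hcoord g i =1 hcoord h i}.
Proof. by apply: filterS => x; rewrite /hcoord => ->. Qed.

Lemma near_vcoord g h (s : R) : {near s, g =1 h} -> {near s, vcoord g =1 vcoord h}.
Proof. by apply: filterS => x; rewrite /vcoord => ->. Qed.

Lemma near_hvelocity g h (s : R) : {near s, g =1 h} -> hvelocity g s = hvelocity h s.
Proof.
move=> gh; apply/matrixP => i j; rewrite !mxE !derive1E.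
exact/near_eq_derive/near_hcoord.
Qed.

Lemma near_horizontal_at g h (s : R) :
  {near s, g =1 h} -> horizontal_at g s -> horizontal_at h s.
Proof.
move=> gh [dh dv e]; split=> [i||].
- by apply: near_eq_derivable (dh i); exact: near_hcoord.
- by apply: near_eq_derivable dv; exact: near_vcoord.
- rewrite horizontal_eq_omega -(near_hvelocity _ _ _ gh) -(nbhs_singleton gh).
  rewrite -horizontal_eq_omega -e !derive1E.
  by symmetry; exact/near_eq_derive/near_vcoord.
Qed.

Definition ray q z (m s : R) : heis R n := hmul q ((s - m) *: z, 0).

Lemma is_derive_affine (a b m s : R) :
  is_derive s (1 : R) (fun x : R => a + (x - m) * b) b.
Proof.
have -> : (fun x : R => a + (x - m) * b) = cst (a - m * b) + b *: (id : R -> R).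
  by apply/funext => x; rewrite !fctE /= /GRing.scale /=; ring.
rewrite -[b in X in is_derive _ _ _ X]add0r -[b in X in is_derive _ _ _ X]mulr1.
exact: is_deriveD.
Qed.

Lemma hcoord_ray q z m i : hcoord (ray q z m) i = fun s => q.1 i 0 + (s - m) * z i 0.
Proof. by apply/funext => s; rewrite /hcoord /= !mxE. Qed.

Lemma vcoord_ray q z m :
  vcoord (ray q z m) = fun s => q.2 + (s - m) * (2 * omega q.1 z).
Proof. by apply/funext => s; rewrite /vcoord /= omegaZr; ring. Qed.

Lemma hvelocity_ray q z m s : hvelocity (ray q z m) s = z.
Proof.
apply/matrixP => i j; rewrite (ord1 j) !mxE hcoord_ray derive1E.
by apply: derive_val; exact: is_derive_affine.
Qed.

Lemma horizontal_at_ray q z m s : horizontal_at (ray q z m) s.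
Proof.
split=> [i||].
- by rewrite hcoord_ray; have [] := is_derive_affine (q.1 i 0) (z i 0) m s.
- by rewrite vcoord_ray; have [] := is_derive_affine q.2 (2 * omega q.1 z) m s.
rewrite horizontal_eq_omega hvelocity_ray /= omegaDl omegaZl omega_diag mulr0 addr0.
rewrite vcoord_ray derive1E.
by apply: derive_val; exact: is_derive_affine.
Qed.

Local Open Scope classical_set_scope.

(** Stated coordinate by coordinate, because a gluing argument for the Euclidean
    distance would need its triangle inequality. *)
Definition lipschitz_curve (g : R -> heis R n) (b L : R) :=
  forall s t, 0 <= s <= b -> 0 <= t <= b ->
    (forall i, `|hcoord g i s - hcoord g i t| <= L * `|s - t|) /\
    `|vcoord g s - vcoord g t| <= L * `|s - t|.

Definition glue T (m : R) (g h : R -> T) s := if s <= m then g s else h s.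

Lemma glue_lipschitz (m L1 L2 : R) (f k : R -> R) : 0 <= L1 -> 0 <= L2 ->
    f m = k m ->
    (forall s t, 0 <= s <= m -> 0 <= t <= m -> `|f s - f t| <= L1 * `|s - t|) ->
    (forall s t, `|k s - k t| <= L2 * `|s - t|) -> 0 <= m ->
  forall s t, 0 <= s -> 0 <= t ->
    `|glue R m f k s - glue R m f k t| <= (L1 + L2) * `|s - t|.
Proof.
move=> L10 L20 fk fL kL m0 s t.
wlog st : s t / s <= t.
  move=> H s0 t0; case: (leP s t) => [|/ltW] st; first exact: H.
  by rewrite distrC (distrC s); exact: H.
move=> s0 t0; rewrite /glue.
case: (leP t m) => tm.
  rewrite (le_trans st tm); apply: le_trans (fL _ _ _ _) _; rewrite ?s0 ?t0//=.
    exact: le_trans st tm.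
  by rewrite ler_wpM2r// lerDl.
case: (leP s m) => sm; last first.
  by apply: le_trans (kL _ _) _; rewrite ler_wpM2r// lerDr.
have h1 := fL s m; rewrite s0 sm m0 lexx in h1.
have {}h1 := h1 isT isT; have h2 := kL m t.
rewrite -(subrK (f m) (f s)) -addrA {2}fk (le_trans (ler_normD _ _))//.
rewrite mulrDl lerD//.
  by apply: le_trans h1 _; rewrite ler_wpM2l// !ler0_norm ?subr_le0//; lra.
by apply: le_trans h2 _; rewrite ler_wpM2l// !ler0_norm ?subr_le0//; lra.
Qed.

Lemma affine_lipschitz (a b m : R) s t :
  `|(a + (s - m) * b) - (a + (t - m) * b)| <= `|b| * `|s - t|.
Proof. by rewrite -normrM le_eqVlt; apply/orP; left; apply/eqP; congr (`|_|); ring. Qed.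

Lemma lipschitz_glue_ray g q z m b L : 0 <= L -> 0 <= m -> g m = q ->
    lipschitz_curve g m L ->
  exists2 L', 0 <= L' & lipschitz_curve (glue _ m g (ray q z m)) b L'.
Proof.
move=> L0 m0 gm gL.
pose K := \sum_i `|z i 0| + `|2 * omega q.1 z|.
have K0 : 0 <= K by rewrite addr_ge0// sumr_ge0.
have zK i : `|z i 0| <= K.
  by rewrite /K (bigD1 i)//= -addrA lerDl addr_ge0// sumr_ge0.
have oK : `|2 * omega q.1 z| <= K by rewrite lerDr sumr_ge0.
exists (L + K); first exact: addr_ge0.
move=> s t /andP[s0 _] /andP[t0 _]; split=> [i|].
- have -> : hcoord (glue _ m g (ray q z m)) i =
      glue R m (hcoord g i) (hcoord (ray q z m) i).
    by apply/funext => x; rewrite /hcoord /glue; case: ifP.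
  apply: glue_lipschitz s0 t0 => //.
  + by rewrite hcoord_ray subrr mul0r addr0 /hcoord gm.
  + by move=> x y xm ym; have [] := gL x y xm ym.
  + move=> x y; rewrite hcoord_ray; apply: le_trans (affine_lipschitz _ _ _ _ _) _.
    by rewrite ler_wpM2r.
- have -> : vcoord (glue _ m g (ray q z m)) =
      glue R m (vcoord g) (vcoord (ray q z m)).
    by apply/funext => x; rewrite /vcoord /glue; case: ifP.
  apply: glue_lipschitz s0 t0 => //.
  + by rewrite vcoord_ray subrr mul0r addr0 /vcoord gm.
  + by move=> x y xm ym; have [] := gL x y xm ym.
  + move=> x y; rewrite vcoord_ray; apply: le_trans (affine_lipschitz _ _ _ _ _) _.
    by rewrite ler_wpM2r.
Qed.

Lemma near_glue_l T (g h : R -> T) m s : s < m -> {near s, g =1 glue T m g h}.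
Proof.
by move=> /lt_nbhsl; apply: filterS => x xm; rewrite /glue (ltW xm).
Qed.

Lemma near_glue_r T (g h : R -> T) m s : m < s -> {near s, h =1 glue T m g h}.
Proof.
by move=> /lt_nbhsr; apply: filterS => x xm; rewrite /glue leNgt xm.
Qed.

Lemma ae_neq (c : R) : {ae mu, forall s, s <> c}.
Proof.
exists [set c]; split => //; first exact: lebesgue_measure_set1.
by move=> s /= /contrapT.
Qed.

Context {nrm : 'cV[R]_(n + n) -> R}.
Hypothesis nrm_ge0 : forall z, 0 <= nrm z.

(** The induction appends one side, parametrized by a unit interval, at the end
    of the curve. The length is taken over a half-open interval so that the
    velocity at the corner [m], where the curve need not be differentiable,
    belongs to the new piece only, as a null set. *)
Lemma polygon_curve p zs : exists g,
  [/\ g 0 = p, g (size zs)%:R = polygon p zs,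
      exists2 L, 0 <= L & lipschitz_curve g (size zs)%:R L,
      {ae mu, forall s, 0 <= s <= (size zs)%:R -> horizontal_at g s} &
      measurable_fun `[0:R, (size zs)%:R[ (fun s => nrm (hvelocity g s)) /\
      (\int[mu]_(s in `[0%R:R, (size zs)%:R%R[) (nrm (hvelocity g s))%:E =
        (\sum_(z <- zs) nrm z)%:E)%E].
Proof.
elim/last_ind : zs => [|zs z [g [g0 gm [L L0 gL] gH [gM gI]]]].
  exists (fun=> p); split => //=.
  - by exists 0 => // s t _ _; split=> [i|]; rewrite /hcoord /vcoord subrr normr0 mul0r.
  - apply: aeW => s _; have -> : (fun=> p) = ray p 0 0.
      by apply/funext => x; rewrite /ray scaler0 hmul0r.
    exact: horizontal_at_ray.
  - rewrite set_itvco0 big_nil integral_set0; split => //.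
    exact: measurable_fun_set0.
set m : R := (size zs)%:R in gm gL gH gM gI *.
set q := polygon p zs in gm.
have m0 : 0 <= m by rewrite ler0n.
have m1 : (size (rcons zs z))%:R = m + 1 :> R by rewrite size_rcons -addn1 natrD.
rewrite m1; pose g' := glue _ m g (ray q z m).
have vl s : s < m -> hvelocity g' s = hvelocity g s.
  by move=> sm; symmetry; apply: near_hvelocity; exact: near_glue_l.
have vr s : m < s -> hvelocity g' s = z.
  move=> sm; rewrite -[RHS](hvelocity_ray q z m s); symmetry.
  by apply: near_hvelocity; exact: near_glue_r.
pose F s := nrm (hvelocity g' s).
have Fl : {in `[0:R, m[%classic, (fun s => nrm (hvelocity g s)) =1 F}.
  by move=> s; rewrite inE /= in_itv /= => /andP[_ sm]; rewrite /F vl.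
have Fr : {in `]m, m + 1[%classic, cst (nrm z) =1 F}.
  by move=> s; rewrite inE /= in_itv /= => /andP[ms _]; rewrite /F vr.
have Ml : measurable_fun `[0:R, m[ F by apply: eq_measurable_fun Fl gM.
have Mr' : measurable_fun `]m, (m + 1)[ F.
  by apply: eq_measurable_fun Fr _; exact: measurable_cst.
have Mr : measurable_fun `[m, (m + 1)[ F by apply/measurable_fun_itv_obnd_cbndP.
have U : `[0:R, (m + 1)[ = `[0:R, m[ `|` `[m, (m + 1)[.
  by apply: itv_bndbnd_setU; rewrite bnd_simp// lerDl.
have M : measurable_fun `[0:R, (m + 1)[ F.
  by rewrite U; apply/measurable_funU.
exists g'; split.
- by rewrite /g' /glue m0.
- rewrite /g' /glue gerDl leNgt ltr01 /= /ray addrAC subrr add0r scale1r.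
  by rewrite /polygon -cats1 foldl_cat.
- exact: lipschitz_glue_ray gL.
- have aeF := ae_filter_ringOfSetsType mu.
  apply: filterS2 gH (ae_neq m) => s Hs sNm /andP[s0 sm].
  case: (ltgtP s m) => [sm'|sm'|//].
  + apply: near_horizontal_at (near_glue_l _ _ _ _ _ sm') _.
    by apply: Hs; rewrite s0 ltW.
  + apply: near_horizontal_at (near_glue_r _ _ _ _ _ sm') _.
    exact: horizontal_at_ray.
- have I1 : (\int[mu]_(s in `[0%R:R, m[) (F s)%:E = (\sum_(z <- zs) nrm z)%:E)%E.
    by rewrite -gI; apply: eq_integral => s /Fl <-.
  have I2 : (\int[mu]_(s in `[m, (m + 1)%R[) (F s)%:E = (nrm z)%:E)%E.
    rewrite -integral_itv_obnd_cbnd; last exact/measurable_EFinP.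
    transitivity (\int[mu]_(s in `]m, (m + 1)%R[) (cst (nrm z)%:E s))%E.
      by apply: eq_integral => s /Fr <-.
    rewrite integral_cst//= lebesgue_measure_itv /= lte_fin ltrDl ltr01.
    by rewrite -EFinD addrAC subrr add0r mule1.
  split => //; rewrite U ge0_integral_setU//=.
  + by rewrite [X in (X + _)%E]I1 [X in (_ + X)%E]I2 -EFinD -cats1 big_cat big_seq1.
  + by rewrite -U; apply/measurable_EFinP.
  + by move=> s _; rewrite lee_fin.
  + apply/disj_setPS => s /=; rewrite !in_itv /= => -[/andP[_ h1] /andP[h2 _]].
    by move: (le_lt_trans h2 h1); rewrite ltxx.
Qed.

Lemma eucl_dist_le p q :
  eucl_dist p q <= \sum_i `|(p.1 - q.1) i 0| + `|p.2 - q.2|.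
Proof.
set S := \sum_i _; have S0 : 0 <= S by apply: sumr_ge0.
rewrite /eucl_dist -[leRHS]ger0_norm ?addr_ge0// -(sqrtr_sqr (S + _)) ler_sqrt ?sqr_ge0//.
rewrite [leRHS]sqrrD real_normK ?num_real// lerD2r.
apply: (@le_trans _ _ (S ^+ 2)); last by rewrite lerDl mulrn_wge0// mulr_ge0.
have [//] : dotv (p.1 - q.1) (p.1 - q.1) <= S ^+ 2 /\ 0 <= S.
rewrite /dotv /S; elim/big_rec2 : _ => [|i x y _ [h y0]]; first by rewrite expr0n.
split; last exact: addr_ge0.
rewrite sqrrD real_normK ?num_real// -expr2 -addrA lerD2l.
by rewrite (le_trans h)// lerDr mulrn_wge0// mulr_ge0.
Qed.

Lemma lipschitz_abs_continuous g b L : 0 <= L -> lipschitz_curve g b L ->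
  abs_continuous 0 b g.
Proof.
move=> L0 gL e e0; pose C := (n + n).+1%:R * L.
have C0 : 0 <= C by rewrite mulr_ge0.
have C1 : 0 < C + 1 by rewrite ltr_wpDl.
exists (e / (C + 1)); first exact: divr_gt0.
move=> m u v uv _ small.
have step i : eucl_dist (g (u i)) (g (v i)) <= C * (v i - u i).
  have [au uvi vb] := uv i.
  have [|| h1 h2] := gL (u i) (v i).
  - by rewrite au (le_trans uvi).
  - by rewrite vb (le_trans au).
  have uvE : `|u i - v i| = v i - u i by rewrite distrC ger0_norm ?subr_ge0.
  rewrite uvE in h1 h2.
  apply: le_trans (eucl_dist_le _ _) _.
  rewrite /C mulrSr !mulrDl mul1r lerD//.
  rewrite -mulrA mulr_natl -[X in _ *+ X]card_ord -sumr_const.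
  by apply: ler_sum => j _; have := h1 j; rewrite /hcoord !mxE => h.
apply: (@le_lt_trans _ _ (C * \sum_i (v i - u i))).
  by rewrite mulr_sumr; apply: ler_sum.
apply: (@le_lt_trans _ _ (C * (e / (C + 1)))); first by rewrite ler_wpM2l// ltW.
by rewrite mulrA ltr_pdivrMr// mulrC ltr_pM2l// ltrDl.
Qed.

Lemma polygon_horizontal p zs : exists (a b : R) g,
  [/\ a <= b, horizontal a b g, g a = p, g b = polygon p zs &
      sf_length nrm a b g = (\sum_(z <- zs) nrm z)%:E].
Proof.
have [g [g0 gb [L L0 gL] gH [gM gI]]] := polygon_curve p zs.
exists 0, (size zs)%:R, g; split => //.
- by split => //; exact: lipschitz_abs_continuous gL.
- rewrite /sf_length -gI -integral_itv_bndo_bndc//; exact/measurable_EFinP.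
Qed.

End Polygons.

(** * Increments of absolutely continuous interval functions *)

Section IntervalFunctions.
Context {R : realType}.
Local Open Scope classical_set_scope.
Notation mu := (@lebesgue_measure R).

(** Continuous induction in the form of Cousin's covering lemma: at the supremum
    [c] of the points reached, the step at [c] leads from a point just below
    [c] to a point above it. *)
Lemma straddle_induction (a b : R) (P : R -> Prop) : a <= b -> P a ->
    (forall x, a <= x <= b -> exists2 d : R, 0 < d &
      forall u v, a <= u -> u <= x -> x <= v -> v <= b -> v - u < d ->
        P u -> P v) ->
  P b.
Proof.
move=> ab Pa step.
pose S := [set x | a <= x <= b /\ P x].
have Sa : S a by split; rewrite ?lexx.
have bS : ubound S b by move=> x [/andP[]].
have hS : has_sup S by split; [exists a|exists b].
set c := sup S.
have cb : c <= b by apply: ge_sup => //; exists a.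
have ac : a <= c by exact: (ub_le_sup hS.2).
have [|d d0 dP] := step c; first by rewrite ac.
have [u [/andP[au ub] Pu] uc] : exists2 u, S u & c - d / 4 < u.
  by apply: sup_adherent => //; rewrite divr_gt0.
have uc' : u <= c by apply: (ub_le_sup hS.2); rewrite /S /= au.
pose v := Num.min b (c + d / 4).
have cv : c <= v by rewrite le_min cb lerDl divr_ge0// ltW.
have vb : v <= b by rewrite ge_min lexx.
have vc : v <= c + d / 4 by rewrite ge_min lexx orbT.
have Pv : P v by apply: dP Pu => //; lra.
have vc' : v <= c.
  by apply: ub_le_sup; [exact: hS.2|split => //; rewrite vb (le_trans ac)].
move: Pv vc'; rewrite /v; case: (leP b (c + d / 4)) => // _ _; lra.
Qed.

(** Here [D u v] stands for a quantity attached to the piece of a curve between [u]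
    and [v], such as the norm of its displacement. *)
Definition interval_ac (a b : R) (D : R -> R -> R) :=
  forall e : R, 0 < e -> exists2 d : R, 0 < d &
    forall (m : nat) (u v : 'I_m -> R),
      (forall i, [/\ a <= u i, u i <= v i & v i <= b]) ->
      trivIset setT (fun i => `]u i, v i[) ->
      \sum_i (v i - u i) < d ->
      \sum_i D (u i) (v i) < e.

Lemma interval_ac_seq (a b : R) D (e : R) : interval_ac a b D -> 0 < e ->
  exists2 d : R, 0 < d & forall s : seq (R * R),
    all (fun p => [&& a <= p.1, p.1 <= p.2 & p.2 <= b]) s ->
    pairwise (fun p q => p.2 <= q.1) s ->
    \sum_(p <- s) (p.2 - p.1) < d -> \sum_(p <- s) D p.1 p.2 < e.
Proof.
move=> Dac e0; have [d d0 dP] := Dac e e0; exists d => // s sab sord.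
rewrite !(big_nth (0, 0)) !big_mkord => small.
apply: dP => // [i|].
  by have /and3P[] := all_nthP (0, 0) sab i (ltn_ord i).
have lt_disj (i j : 'I_(size s)) : (i < j)%N -> forall x,
    (nth (0, 0) s i).1 < x < (nth (0, 0) s i).2 ->
    (nth (0, 0) s j).1 < x < (nth (0, 0) s j).2 -> False.
  move=> ij x /andP[_ h1] /andP[h2 _].
  have h := pairwiseP (0, 0) sord i j (ltn_ord i) (ltn_ord j) ij.
  by have := lt_trans (lt_le_trans h1 h) h2; rewrite ltxx.
move=> i j _ _ [x []]; rewrite /= !in_itv /= => xi xj.
case: (ltngtP i j) => [ij|ji|/val_inj //].
- by case: (lt_disj _ _ ij x).
- by case: (lt_disj _ _ ji x).
Qed.

(** Passing from [u] to [v] inside [O] uses up [v - u] of the measure of [O]; this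
    is how the total length of disjoint intervals in [O] is kept below that of
    [O]. *)
Lemma measure_open_step (O : set R) (a u v : R) : open O -> a <= u -> u <= v ->
  (forall x, u < x < v -> O x) ->
  (mu (O `&` `[a, u]) + (v - u)%:E <= mu (O `&` `[a, v]))%E.
Proof.
move=> oO au uv sub.
have mO : measurable O by exact: open_measurable.
have -> : (v - u)%:E = mu `]u, v[.
  rewrite lebesgue_measure_itv /= lte_fin; case: ltP => //.
  by move=> vu; have -> : v = u by [apply/eqP; rewrite eq_le vu]; rewrite subrr.
have disj (x : R) : `[a, u] x -> `]u, v[ x -> False.
  rewrite /= !in_itv /= => /andP[_ h1] /andP[h2 _].
  by move: (le_lt_trans h1 h2); rewrite ltxx.
have subset (x : R) : (O `&` `[a, u] `|` `]u, v[) x -> (O `&` `[a, v]) x.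
  case=> [[Ox]|] /=; rewrite !in_itv /= => /andP[h1 h2].
    by rewrite h1 (le_trans h2).
  by rewrite (le_trans au (ltW h1)) (ltW h2); split => //; apply: sub; rewrite h1.
rewrite -measureU//; last 2 first.
- exact: measurableI.
- apply/seteqP; split => x // [[_ h1] h2]; exact: (disj x).
apply: le_measure; rewrite ?inE.
- by apply: measurableU => //; exact: measurableI.
- exact: measurableI.
- exact: subset.
Qed.

(** If [D] is dominated by the increments of [H] near almost every point, then it
    is dominated by them globally. The exceptional null set is covered by an open
    set [O] of small measure. Climbing from [a] to [b], a step around a good
    point costs an increment of [H] up to a small error, and a step around an
    exceptional point is an interval inside [O]; those intervals are disjoint of
    small total length, so absolute continuity bounds their contribution. *)
Lemma subadditive_le_increment (a b : R) (D : R -> R -> R) (H : R -> R) :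
    a <= b -> D a a <= 0 ->
    (forall u v w, a <= u -> u <= v -> v <= w -> w <= b ->
      D u w <= D u v + D v w) ->
    interval_ac a b D ->
    (forall u v, a <= u -> u <= v -> v <= b -> H u <= H v) ->
    {ae mu, forall x, a <= x <= b -> forall e : R, 0 < e ->
      exists2 d : R, 0 < d & forall u v, a <= u -> u <= x -> x <= v -> v <= b ->
        v - u < d -> D u v <= H v - H u + e * (v - u)} ->
  D a b <= H b - H a.
Proof.
move=> ab Daa Dsub Dac Hmono [A [mA A0 Abad]].
apply/ler_addgt0Pr => e e0.
have [d d0 dP] := interval_ac_seq _ _ _ (e / 2) Dac (divr_gt0 e0 (ltr0n _ 2)).
have [|O [oO AO OA]] := lebesgue_regularity_outer mA _ d0.
  by rewrite [ltLHS]A0.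
have mO : measurable O by exact: open_measurable.
have Od : (mu O < d%:E)%E.
  apply: le_lt_trans OA; rewrite -[leRHS]add0e -[X in (X + _)%E]A0.
  by rewrite -[in leLHS](setDUK AO) measureU2//; exact: measurableD.
pose e1 := e / 2 / (b - a + 1).
have ba1 : 0 < b - a + 1 by lra.
have e10 : 0 < e1 by rewrite !divr_gt0.
(* the intervals of [s] are those on which only absolute continuity is known *)
pose P x := exists s : seq (R * R),
  [/\ all (fun p => [&& a <= p.1, p.1 <= p.2 & p.2 <= x]) s,
      pairwise (fun p q => p.2 <= q.1) s,
      ((\sum_(p <- s) (p.2 - p.1))%:E <= mu (O `&` `[a, x]))%E &
      D a x <= H x - H a + e1 * (x - a) + \sum_(p <- s) D p.1 p.2].
have [s [sab sord slen sD]] : P b.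
  apply: (straddle_induction a b) => // [|x xab].
    by exists [::]; rewrite !big_nil !subrr mulr0 !addr0; split.
  have [xA|xA] := pselect (A x).
  - have : nbhs x O by apply: open_nbhs_nbhs; split => //; exact: AO.
    move=> /nbhs_ballP[r /= r0 rO]; exists r => // u v au ux xv vb uvr.
    move=> [s [sab sord slen sD]].
    have uv := le_trans ux xv.
    exists (rcons s (u, v)); split.
    + rewrite all_rcons /= au uv lexx /=; apply: sub_all sab => p /and3P[-> -> /=].
      by move=> /le_trans; exact.
    + rewrite pairwise_rcons sord andbT /=; apply: sub_all sab => p /and3P[_ _ //].
    + rewrite -cats1 big_cat big_seq1 /= EFinD.
      apply: le_trans (measure_open_step _ _ _ _ oO au uv _); first by rewrite leeD2r.
      move=> y /andP[uy yv]; apply: rO; rewrite /ball /= ltr_norml; lra.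
    + rewrite -cats1 big_cat big_seq1 /=.
      have := Dsub a u v (lexx a) au uv vb.
      have := Hmono u v au uv vb.
      have : e1 * (u - a) <= e1 * (v - a) by rewrite ler_wpM2l ?(ltW e10)// lerB.
      by lra.
  - have xgood : a <= x <= b -> forall e : R, 0 < e ->
        exists2 d : R, 0 < d & forall u v, a <= u -> u <= x -> x <= v -> v <= b ->
        v - u < d -> D u v <= H v - H u + e * (v - u).
      by apply: contrapT => bad; apply: xA; exact: Abad.
    have [r r0 rP] := xgood xab _ e10; exists r => // u v au ux xv vb uvr.
    move=> [s [sab sord slen sD]]; have uv := le_trans ux xv; exists s; split => //.
    + by apply: sub_all sab => p /and3P[-> -> /=] /le_trans; exact.
    + apply: le_trans slen _; apply: le_measure; rewrite ?inE.
      * exact: measurableI.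
      * exact: measurableI.
      * by apply: setIS => y; rewrite /= !in_itv /= => /andP[-> /le_trans]; exact.
    + have := Dsub a u v (lexx a) au uv vb; have := rP u v au ux xv vb uvr.
      have : e1 * (v - a) = e1 * (u - a) + e1 * (v - u) by ring.
      by lra.
have len : \sum_(p <- s) (p.2 - p.1) < d.
  rewrite -lte_fin (le_lt_trans slen)// (le_lt_trans _ Od)//.
  by apply: le_measure; rewrite ?inE//; exact: measurableI.
have := dP s sab sord len.
have : e1 * (b - a) <= e / 2.
  rewrite /e1 mulrAC ler_pdivrMr// ler_wpM2l//; first by rewrite divr_ge0// ltW.
  by rewrite lerDl.
by lra.
Qed.

End IntervalFunctions.

(** * Straddled derivatives and primitives *)

Section RealAnalysis.
Context {R : realType}.
Local Open Scope classical_set_scope.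
Notation mu := (@lebesgue_measure R).

(** The difference quotients over intervals that contain [x] converge to the
    derivative at [x], whether or not [x] is an end point. *)
Lemma derivable_straddle (f : R -> R) (x : R) : derivable f x 1 ->
  forall e : R, 0 < e -> exists2 d : R, 0 < d &
    forall u v, u <= x -> x <= v -> v - u < d ->
      `|f v - f u - (v - u) * derive1 f x| <= e * (v - u).
Proof.
move=> fx e e0.
have [d d0 dP] : exists2 d : R, 0 < d & forall h, `|h| < d ->
    `|f (h + x) - f x - h * derive1 f x| <= e * `|h|.
  have /cvgrPdist_le /(_ e e0) := fx.
  rewrite -/('D_1 f x) -derive1E near_withinE => /nbhs_ballP[d /= d0 dP].
  exists d => // h hd; have [->|hN0] := eqVneq h 0.
    by rewrite add0r subrr mul0r subrr !normr0 mulr0.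
  have := dP h; rewrite /ball /= sub0r normrN => /(_ hd hN0).
  rewrite /GRing.scale /= mulr1 => dh.
  have -> : f (h + x) - f x - h * derive1 f x =
      - h * (derive1 f x - h^-1 * (f (h + x) - f x)).
    by rewrite mulrBr mulNr mulNr mulrA mulfV// mul1r; ring.
  by rewrite normrM normrN mulrC ler_wpM2r.
exists d => // u v ux xv uvd.
have := dP (v - x); have := dP (u - x); rewrite !subrK.
rewrite (ler0_norm (_ : u - x <= 0)) ?subr_le0//.
rewrite (ger0_norm (_ : 0 <= v - x)) ?subr_ge0// => hu hv.
have {}hu := hu ltac:(lra); have {}hv := hv ltac:(lra).
have -> : f v - f u - (v - u) * derive1 f x =
  (f v - f x - (v - x) * derive1 f x) - (f u - f x - (u - x) * derive1 f x) by ring.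
by apply: le_trans (ler_normB _ _) _; lra.
Qed.

(** The integral of a nonnegative function is a supremum over the simple functions
    below it, hence monotone without measurability. This matters for the speed
    of a curve, which is controlled only almost everywhere. *)
Lemma ge0_le_integral_any (f1 f2 : R -> \bar R) :
  (forall x, 0 <= f1 x)%E -> (forall x, f1 x <= f2 x)%E ->
  (\int[mu]_x f1 x <= \int[mu]_x f2 x)%E.
Proof.
move=> f10 f12.
rewrite !ge0_integralTE//; last by move=> x; exact: le_trans (f10 x) (f12 x).
apply: le_ereal_sup => _ [h hf <-]; exists h => // x.
by apply: le_trans (hf x) (f12 x).
Qed.

(** Lebesgue's differentiation theorem, for [f] extended by [0] outside [B]. *)
Lemma integral_primitive (B : set R) (f : R -> R) : measurable B ->
    measurable_fun B f -> (forall x, 0 <= f x) ->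
    (\int[mu]_(x in B) (f x)%:E < +oo)%E ->
  exists H : R -> R, [/\ {homo H : x y / x <= y},
    forall x y, ((H y - H x)%:E <= \int[mu]_(x in B) (f x)%:E)%E &
    {ae mu, forall x, B x -> derivable H x 1 /\ derive1 H x = f x}].
Proof.
move=> mB mf f0 fin.
pose G := f \_ B.
have G0 x : 0 <= G x by rewrite /G patchE; case: ifP.
have mG : measurable_fun setT G by apply/(measurable_restrictT _ mB); exact: mf.
have GE : (\int[mu]_x (G x)%:E = \int[mu]_(x in B) (f x)%:E)%E.
  by rewrite [RHS]integral_mkcond restrict_EFin.
have iG : mu.-integrable setT (EFin \o G).
  apply/integrableP; split; first exact/measurable_EFinP.
  by under eq_integral do rewrite /= ger0_norm//; rewrite GE.
have iGy y : mu.-integrable `]-oo, y] (EFin \o G) by apply: integrableS iG.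
have lG : locally_integrable setT G by apply: open_integrable_locally => //; exact: openT.
pose H x := (\int[mu]_(t in `]-oo, x]) G t)%R.
have finH x : (\int[mu]_(t in `]-oo, x]) (G t)%:E)%E \is a fin_num.
  exact: integrable_fin_num.
have HE x : (H x)%:E = (\int[mu]_(t in `]-oo, x]) (G t)%:E)%E by rewrite fineK.
have H0 x : 0 <= H x.
  by rewrite -lee_fin HE; apply: integral_ge0 => t _; rewrite lee_fin.
have HG x : ((H x)%:E <= \int[mu]_(x in B) (f x)%:E)%E.
  rewrite HE -GE; apply: ge0_subset_integral => //.
  - exact/measurable_EFinP.
  - by move=> t _; rewrite lee_fin.
exists H; split.
- move=> x y xy; rewrite -lee_fin !HE; apply: ge0_subset_integral => //.
  + by apply/measurable_EFinP; apply: measurable_funS mG.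
  + by move=> t _; rewrite lee_fin.
  + by apply: subset_itvl; rewrite bnd_simp.
- by move=> x y; apply: le_trans (HG y); rewrite lee_fin; have := H0 x; lra.
- have aeF := ae_filter_ringOfSetsType mu.
  apply: filterS (FTC1Ny iGy lG) => x [dH HG'] Bx; split => //.
  by rewrite HG' /G patchE mem_set.
Qed.

End RealAnalysis.

(** * Displacement and area along a horizontal curve *)

Section HorizontalCurves.
Context {R : realType} {n : nat} {N : heis R n -> R}.
Hypothesis hN : homogeneous_norm N.
Implicit Types (z w : 'cV[R]_(n + n)) (p q : heis R n).
Local Open Scope classical_set_scope.
Notation mu := (@lebesgue_measure R).

Definition omega_bound := 8 / N (0, 1) ^+ 2.

Lemma omega_bound_ge0 : 0 <= omega_bound.
Proof. by rewrite divr_ge0// sqr_ge0. Qed.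

Lemma omega2_le z w : `|2 * omega z w| <= omega_bound * (N (z, 0) * N (w, 0)).
Proof.
have N1 : 0 < N (0, 1) ^+ 2 by rewrite exprn_gt0// (hnorm_vertical_gt0 hN).
rewrite /omega_bound mulrAC ler_pdivlMr// normrM ger0_norm// -mulrA.
by have := omega_le hN z w; lra.
Qed.

Lemma velocity_straddle (g : R -> heis R n) (x : R) :
    (forall i, derivable (hcoord g i) x 1) ->
  forall e : R, 0 < e -> exists2 d : R, 0 < d &
    forall u v, u <= x -> x <= v -> v - u < d ->
      N ((g v).1 - (g u).1 - (v - u) *: hvelocity g x, 0) <= e * (v - u).
Proof.
move=> dg e e0.
pose e1 := e / (@norm_bound R n N + 1).
have nb := norm_bound_ge0 hN.
have nb1 : 0 < @norm_bound R n N + 1 by rewrite ltr_wpDl.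
have e10 : 0 < e1 by exact: divr_gt0.
have [d d0 dP] := fin_all_exists2 (fun i => derivable_straddle _ x (dg i) _ e10).
exists (\big[Num.min/1]_i d i); first by apply: lt_bigmin.
move=> u v ux xv uvd.
have vu0 : 0 <= v - u by lra.
apply: (@le_trans _ _ (@norm_bound R n N * (e1 * (v - u)))).
  apply: hnorm_le_bound => // i.
  have := dP i u v ux xv (lt_le_trans uvd (bigmin_le 1 i d)).
  by rewrite /hcoord !mxE.
rewrite mulrA ler_wpM2r// /e1 mulrA ler_pdivrMr// mulrC ler_wpM2l ?ltW//.
by rewrite ltrDl.
Qed.

Context {g : R -> heis R n} {a b : R}.
Hypothesis gac : abs_continuous a b g.

Lemma abs_continuous_uniform (e : R) : 0 < e -> exists2 d : R, 0 < d &
  forall s t, a <= s -> s <= t -> t <= b -> t - s < d -> eucl_dist (g s) (g t) < e.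
Proof.
move=> e0; have [d d0 dP] := gac e e0; exists d => // s t as_ st tb std.
have := dP 1%N (fun=> s) (fun=> t); rewrite !big_ord1; apply => //.
by move=> i j _ _ _; rewrite (ord1 i) (ord1 j).
Qed.

Lemma interval_ac_eucl (c d C : R) (D : R -> R -> R) : a <= c -> d <= b -> 0 <= C ->
    (forall u v, c <= u -> u <= v -> v <= d ->
      D u v <= C * eucl_dist (g u) (g v)) ->
  interval_ac c d D.
Proof.
move=> ac db C0 DC e e0.
have C1 : 0 < C + 1 by rewrite ltr_wpDl.
have [r r0 rP] := gac (e / (C + 1)) (divr_gt0 e0 C1).
exists r => // m u v uv disj small.
apply: (@le_lt_trans _ _ (C * \sum_i eucl_dist (g (u i)) (g (v i)))).
  by rewrite mulr_sumr; apply: ler_sum => i _; have [? ? ?] := uv i; exact: DC.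
apply: (@le_lt_trans _ _ (C * (e / (C + 1)))).
  rewrite ler_wpM2l// ltW// rP// => i; have [h1 h2 h3] := uv i.
  by split=> //; [exact: le_trans h1|exact: le_trans db].
by rewrite mulrA ltr_pdivrMr// mulrC ltr_pM2l// ltrDl.
Qed.

Context {H : R -> R}.
Hypothesis Hmono : {homo H : x y / x <= y}.

Definition regular_time x := [/\ horizontal_at g x, derivable H x 1 &
  derive1 H x = N (hvelocity g x, 0)].

Hypothesis ae_reg : {ae mu, forall x, a <= x <= b -> regular_time x}.

Lemma speed_le_increment x : regular_time x -> forall e : R, 0 < e ->
  exists2 d : R, 0 < d & forall u v, u <= x -> x <= v -> v - u < d ->
    (v - u) * N (hvelocity g x, 0) <= H v - H u + e * (v - u).
Proof.
move=> [_ dH Hx] e e0; have [d d0 dP] := derivable_straddle _ _ dH _ e0.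
exists d => // u v ux xv uvd; have := dP u v ux xv uvd; rewrite Hx ler_norml.
by move=> /andP[+ _]; lra.
Qed.

(** The mean value inequality for the norm [z |-> N (z, 0)]: near a regular time
    the displacement is the speed times the duration up to a small error. *)
Lemma displacement_le c d : a <= c -> c <= d -> d <= b ->
  N ((g d).1 - (g c).1, 0) <= H d - H c.
Proof.
move=> ac cd db.
apply: (subadditive_le_increment c d (fun u v => N ((g v).1 - (g u).1, 0))) => //.
- by rewrite subrr hnorm0.
- move=> u v w _ _ _ _.
  have -> : (g w).1 - (g u).1 = (g v).1 - (g u).1 + ((g w).1 - (g v).1).
    by rewrite [RHS]addrC addrA subrK.
  exact: hnorm_triangle.
- apply: (@interval_ac_eucl _ _ (@norm_bound R n N)) => //.
    exact: norm_bound_ge0.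
  move=> u v _ _ _; rewrite -(hnorm_opp hN) opprB.
  exact: hnorm_le_eucl.
- by move=> u v _ uv _; exact: Hmono.
- have aeF := ae_filter_ringOfSetsType mu.
  apply: filterS ae_reg => x xreg /andP[cx xd] e e0.
  have {}xreg : regular_time x by apply: xreg; rewrite (le_trans ac) ?(le_trans xd).
  have [[dg _ _] _ _] := xreg.
  have [r1 r10 r1P] := velocity_straddle _ _ dg _ (divr_gt0 e0 (ltr0n _ 2)).
  have [r2 r20 r2P] := speed_le_increment _ xreg _ (divr_gt0 e0 (ltr0n _ 2)).
  exists (Num.min r1 r2); first by rewrite lt_min r10.
  move=> u v cu ux xv vd; rewrite lt_min => /andP[uv1 uv2].
  have h1 := r1P u v ux xv uv1; have h2 := r2P u v ux xv uv2.
  rewrite -[(g v).1 - (g u).1](subrK ((v - u) *: hvelocity g x)).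
  apply: le_trans (hnorm_triangle hN _ _) _.
  by rewrite hnorm_scale// ger0_norm; lra.
Qed.

(** For fixed [c] the area between [g c] and [g x] has derivative
    [2 * omega ((g x).1 - (g c).1) (hvelocity g x)] with respect to [x], because [g] is
    horizontal. It is bounded by the oscillation [M] times the speed. *)
Lemma area_le c d M : a <= c -> c <= d -> d <= b -> 0 <= M ->
    (forall x, c <= x -> x <= d -> N ((g x).1 - (g c).1, 0) <= M) ->
  `|area (g c) (g d)| <= omega_bound * M * (H d - H c).
Proof.
move=> ac cd db M0 MP.
have K0 := omega_bound_ge0; have omega2 := omega2_le.
move: omega_bound K0 omega2 => K K0 omega2.
pose D u v := `|(g v).2 - (g u).2 - 2 * omega (g c).1 ((g v).1 - (g u).1)|.
have -> : `|area (g c) (g d)| = D c d by rewrite areaE.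
rewrite mulrBr.
apply: (subadditive_le_increment c d D (fun x => K * M * H x)) => //.
- by rewrite /D !subrr omega0r mulr0 subrr normr0.
- move=> u v w _ _ _ _; apply: le_trans (ler_normD _ _).
  rewrite le_eqVlt; apply/orP; left; apply/eqP; congr (`|_|).
  by rewrite !omegaDr !omegaNr; ring.
- apply: (@interval_ac_eucl _ _
    (1 + K * (N ((g c).1, 0) * @norm_bound R n N))) => //.
    apply: addr_ge0 => //; apply: mulr_ge0 => //.
    by apply: mulr_ge0; [exact: hnorm_ge0|exact: norm_bound_ge0].
  move=> u v _ _ _; rewrite /D; apply: le_trans (ler_normB _ _) _.
  rewrite [leRHS]mulrDl mul1r lerD//; first by rewrite distrC vert_le_eucl.
  apply: le_trans (omega2 _ _) _; rewrite -!mulrA ler_wpM2l//.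
  rewrite ler_wpM2l ?(hnorm_ge0 hN)//.
  by rewrite -(hnorm_opp hN) opprB hnorm_le_eucl.
- by move=> u v _ uv _; rewrite ler_wpM2l ?mulr_ge0// Hmono.
- have aeF := ae_filter_ringOfSetsType mu.
  apply: filterS ae_reg => x xreg /andP[cx xd] e e0.
  have {}xreg : regular_time x by apply: xreg; rewrite (le_trans ac) ?(le_trans xd).
  have [[dg dv hor] _ _] := xreg.
  pose W := K * N ((g c).1, 0); pose V := K * M.
  have W0 : 0 <= W by rewrite mulr_ge0// (hnorm_ge0 hN).
  have V0 : 0 <= V by rewrite mulr_ge0.
  (* [W], [V] and [1] weight the errors made in the horizontal velocity, in [H] and
     in the vertical velocity *)
  pose S := 1 + W + V; have S0 : 0 < S by rewrite /S; lra.
  have eS : 0 < e / S by exact: divr_gt0.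
  have [r1 r10 r1P] := velocity_straddle _ _ dg _ eS.
  have [r2 r20 r2P] := speed_le_increment _ xreg _ eS.
  have [r3 r30 r3P] := derivable_straddle _ _ dv _ eS.
  exists (Num.min r1 (Num.min r2 r3)); first by rewrite !lt_min r10 r20.
  move=> u v cu ux xv vd; rewrite !lt_min => /and3P[uv1 uv2 uv3].
  have h1 := r1P u v ux xv uv1; have h2 := r2P u v ux xv uv2.
  have h3 := r3P u v ux xv uv3.
  have vu0 : 0 <= v - u by lra.
  have hvE : derive1 (vcoord g) x - 2 * omega (g c).1 (hvelocity g x) =
      2 * omega ((g x).1 - (g c).1) (hvelocity g x).
    by rewrite hor horizontal_eq_omega omegaDl omegaNl; ring.
  have split_D : D u v <=
      `|vcoord g v - vcoord g u - (v - u) * derive1 (vcoord g) x| +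
      `|(v - u) * (2 * omega ((g x).1 - (g c).1) (hvelocity g x))| +
      `|2 * omega (g c).1 ((g v).1 - (g u).1 - (v - u) *: hvelocity g x)|.
    rewrite -hvE; apply: le_trans (lerD (ler_normD _ _) (lexx _)).
    apply: le_trans (ler_normB _ _).
    rewrite le_eqVlt; apply/orP; left; apply/eqP; congr (`|_|).
    by rewrite !omegaDr !omegaNr omegaZr /vcoord; ring.
  have b1 : `|(v - u) * (2 * omega ((g x).1 - (g c).1) (hvelocity g x))| <=
      V * ((v - u) * N (hvelocity g x, 0)).
    rewrite normrM (ger0_norm vu0) mulrCA ler_wpM2l//.
    apply: le_trans (omega2 _ _) _; rewrite /V -mulrA ler_wpM2l//.
    by rewrite ler_wpM2r ?(hnorm_ge0 hN)// MP.
  have b2 : `|2 * omega (g c).1 ((g v).1 - (g u).1 - (v - u) *: hvelocity g x)|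
      <= W * (e / S * (v - u)).
    apply: le_trans (omega2 _ _) _; rewrite /W -mulrA ler_wpM2l//.
    by rewrite ler_wpM2l ?(hnorm_ge0 hN).
  have b3 : V * ((v - u) * N (hvelocity g x, 0)) <=
      V * (H v - H u + e / S * (v - u)) by rewrite ler_wpM2l.
  have -> : e * (v - u) = e / S * (v - u) + W * (e / S * (v - u)) +
      V * (e / S * (v - u)).
    have eE : e = e / S * S by rewrite divfK ?lt0r_neq0.
    by rewrite [in LHS]eE; move: (e / S) => q; rewrite /S; ring.
  rewrite -/V -mulrBr; move: b1 b2 b3 split_D h3.
  by rewrite mulrDr; lra.
Qed.

End HorizontalCurves.

(** * Homogeneous distance and sub-Finsler length *)

Section Lower.
Context {R : realType} {n : nat} {N : heis R n -> R}.
Hypothesis hN : homogeneous_norm N.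
Implicit Types (z w : 'cV[R]_(n + n)) (p q : heis R n).
Local Open Scope classical_set_scope.
Notation mu := (@lebesgue_measure R).

Definition subdivision (a b : R) (m i : nat) : R := a + i%:R * ((b - a) / m.+1%:R).

Lemma subdivision0 a b m : subdivision a b m 0 = a.
Proof. by rewrite /subdivision mul0r addr0. Qed.

Lemma subdivision_last a b m : subdivision a b m m.+1 = b.
Proof. by rewrite /subdivision mulrCA divff// mulr1 addrC subrK. Qed.

Lemma subdivisionB a b m i :
  subdivision a b m i.+1 - subdivision a b m i = (b - a) / m.+1%:R.
Proof. by rewrite /subdivision mulrSr; ring. Qed.

Lemma subdivision_mono a b m : a <= b -> {homo subdivision a b m : i j / (i <= j)%N >-> i <= j}.
Proof.
by move=> ab i j ij; rewrite lerD2l ler_wpM2r ?ler_nat// divr_ge0 ?subr_ge0.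
Qed.

Section Curve.
Context {g : R -> heis R n} {a b : R}.
Hypotheses (ab : a <= b) (gac : abs_continuous a b g).

Lemma horizontal_uniform (e : R) : 0 < e -> exists2 d : R, 0 < d &
  forall s t, a <= s <= b -> a <= t <= b -> `|s - t| < d ->
    N ((g s).1 - (g t).1, 0) <= e.
Proof.
move=> e0; have nb := norm_bound_ge0 hN.
have nb1 : 0 < @norm_bound R n N + 1 by rewrite ltr_wpDl.
have [d d0 dP] := abs_continuous_uniform gac _ (divr_gt0 e0 nb1).
have bound (x : R) : x < e / (@norm_bound R n N + 1) -> @norm_bound R n N * x <= e.
  move=> xe; apply: (@le_trans _ _ (@norm_bound R n N * (e / (@norm_bound R n N + 1)))).
    by rewrite ler_wpM2l// ltW.
  by rewrite mulrA ler_pdivrMr// mulrC ler_wpM2l ?ltW// ltrDl.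
exists d => // s t /andP[as_ sb] /andP[at_ tb] std.
have [st|/ltW ts] := leP s t.
  apply: le_trans (hnorm_le_eucl hN _ _) (bound _ _); apply: dP => //.
  by move: std; rewrite distrC ger0_norm ?subr_ge0.
rewrite -(hnorm_opp hN) opprB.
apply: le_trans (hnorm_le_eucl hN _ _) (bound _ _); apply: dP => //.
by move: std; rewrite ger0_norm ?subr_ge0.
Qed.

(** Cut the curve into a fine chain. The horizontal parts of the steps add up to at
    most the increment of [H], and the areas to at most a constant times the
    oscillation over one step times that increment, which is as small as wanted. *)
Lemma hdist_le_increment (H : R -> R) : {homo H : x y / x <= y} ->
    {ae mu, forall x, a <= x <= b -> @regular_time R n N g H x} ->
  hdist N (g a) (g b) <= H b - H a.
Proof.
move=> Hmono ae_reg; apply/ler_addgt0Pr => e e0.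
have Hab : 0 <= H b - H a by rewrite subr_ge0 Hmono.
have N1 : 0 < N (0, 1) := hnorm_vertical_gt0 hN.
pose Q := @omega_bound R n N * (H b - H a) * N (0, 1) ^+ 2.
have Q0 : 0 <= Q.
  by apply: mulr_ge0; [apply: mulr_ge0 => //; exact: omega_bound_ge0|exact: sqr_ge0].
have Q1 : 0 < Q + 1 by rewrite ltr_wpDl.
(* the oscillation for which the total area has vertical norm at most [e] *)
pose M := e ^+ 2 / (Q + 1).
have M0 : 0 < M by rewrite divr_gt0// exprn_gt0.
have [d d0 dP] := horizontal_uniform _ M0.
pose m := Num.trunc ((b - a) / d).
have step_lt : (b - a) / m.+1%:R < d.
  rewrite ltr_pdivrMr// mulrC -ltr_pdivrMr// -truncn_lt_nat//.
  by rewrite divr_ge0 ?subr_ge0// ltW.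
pose t := subdivision a b m.
have tmono : {homo t : i j / (i <= j)%N >-> i <= j} by exact: subdivision_mono.
have t0 : t 0%N = a by exact: subdivision0.
have tm : t m.+1 = b by exact: subdivision_last.
have at_ i : a <= t i by rewrite -t0 tmono.
have tb (i : 'I_m.+1) : t i.+1 <= b by rewrite -tm tmono// ltn_ord.
have tele : \sum_(i < m.+1) (H (t i.+1) - H (t i)) = H b - H a.
  by rewrite -tm -t0 -(telescope_sumr (H \o t) (leq0n m.+1)) big_mkord.
have -> : hdist N (g a) (g b) = N (hmul (hinv ((g \o t) 0%N)) ((g \o t) m.+1)).
  by rewrite /= t0 tm.
apply: le_trans (hnorm_chain_le hN (g \o t) m.+1) _.
apply: lerD.
  rewrite -tele; apply: ler_sum => i _.
  apply: (displacement_le hN gac Hmono ae_reg) => //.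
  exact: tmono.
have area_small : `|chain_area (g \o t) m.+1| <= @omega_bound R n N * M * (H b - H a).
  apply: le_trans (ler_norm_sum _ _ _) _; rewrite -tele mulr_sumr.
  apply: ler_sum => i _; apply: (area_le hN gac Hmono ae_reg) => //.
  - exact: tmono.
  - exact: ltW.
  - move=> x tx xt; apply: dP.
    + by rewrite (le_trans (at_ i))// (le_trans xt).
    + by rewrite at_ (le_trans (tmono i i.+1 _)).
    + rewrite ger0_norm ?subr_ge0//; apply: le_lt_trans step_lt.
      by rewrite -(subdivisionB a b m i) lerB.
rewrite -ler_sqr ?nnegrE ?(hnorm_ge0 hN) ?(ltW e0)// hnorm_vertical_sq//.
apply: le_trans (ler_wpM2r (sqr_ge0 _) area_small) _.
have -> : @omega_bound R n N * M * (H b - H a) * N (0, 1) ^+ 2 = Q * M.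
  by rewrite /Q; ring.
rewrite /M mulrA ler_pdivrMr// mulrC ler_wpM2l ?sqr_ge0//.
by rewrite lerDl.
Qed.

Lemma hnorm_dist z w : `|N (z, 0) - N (w, 0)| <= N (z - w, 0).
Proof.
rewrite ler_norml; apply/andP; split.
  have := hnorm_triangle hN z (w - z); rewrite [z + _]addrC subrK.
  by rewrite -(hnorm_opp hN (w - z)) opprB; lra.
by have := hnorm_triangle hN (z - w) w; rewrite subrK; lra.
Qed.

(** Freezing the curve outside [a, b] gives difference quotients that are
    continuous on the whole line. *)
Definition clamp (s : R) := Num.max a (Num.min s b).

Lemma clamp_in s : a <= clamp s <= b.
Proof. by rewrite /clamp le_max lexx ge_max ab ge_min lexx orbT. Qed.

Lemma clamp_id s : a <= s <= b -> clamp s = s.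
Proof.
by move=> /andP[as_ sb]; rewrite /clamp (min_idPl sb) (max_idPr as_).
Qed.

Lemma clamp_contract s t : `|clamp s - clamp t| <= `|s - t|.
Proof.
rewrite /clamp.
wlog st : s t / s <= t.
  move=> h; have [st|/ltW st] := leP s t; first exact: h.
  by rewrite distrC (distrC s); exact: h.
rewrite !ler0_norm ?subr_le0//; last first.
  by rewrite ge_max le_max lexx /= le_max le_min !ge_min st lexx orbT /= !orbT.
case: (leP s b) => ?; case: (leP t b) => ?; rewrite /Num.max; do 2?case: ifP; lra.
Qed.

(** The speed is the pointwise limit of the norms of difference quotients. *)
Lemma speed_measurable (B : set R) : measurable B ->
    (forall x, B x -> a < x < b /\ forall i, derivable (hcoord g i) x 1) ->
  measurable_fun B (fun x => N (hvelocity g x, 0)).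
Proof.
move=> mB BP.
pose incr (k : nat) s := (g (clamp (s + k.+1%:R^-1))).1 - (g (clamp s)).1.
pose quot k s := k.+1%:R * N (incr k s, 0).
have mquot k : measurable_fun setT (quot k).
  apply: measurable_funM; first exact: measurable_cst.
  apply: continuous_measurable_fun => s.
  apply/cvgrPdist_le => e e0.
  have [d d0 dP] := horizontal_uniform _ (divr_gt0 e0 (ltr0n _ 2)).
  near=> t.
  have std : `|s - t| < d by near: t; exact: (near_ball s d d0).
  apply: le_trans (hnorm_dist _ _) _.
  have -> : incr k s - incr k t =
      ((g (clamp (s + k.+1%:R^-1))).1 - (g (clamp (t + k.+1%:R^-1))).1) -
      ((g (clamp s)).1 - (g (clamp t)).1).
    by rewrite /incr opprB opprB addrACA [RHS]addrACA; congr (_ + _); rewrite addrC.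
  apply: le_trans (hnorm_triangle hN _ _) _; rewrite (hnorm_opp hN).
  rewrite [leRHS](splitr e) lerD//; apply: dP; rewrite ?clamp_in//.
    by apply: le_lt_trans (clamp_contract _ _) _; rewrite opprD addrACA subrr addr0.
  exact: le_lt_trans (clamp_contract _ _) _.
apply: (measurable_fun_cvg (h := quot)).
  by move=> k; apply: measurable_funTS.
move=> x Bx; have [/andP[ax xb] dg] := BP x Bx.
apply/cvgrPdist_le => e e0.
have [d d0 dP] := velocity_straddle hN g x dg _ e0.
have r0 : 0 < Num.min d (b - x) by rewrite lt_min d0 subr_gt0.
near=> k.
have : k.+1%:R^-1 < Num.min d (b - x).
  by near: k; exact: (near_infty_natSinv_lt (PosNum r0)).
rewrite lt_min => /andP[kd kb].
have k0 : 0 < k.+1%:R^-1 :> R by rewrite invr_gt0.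
have incrE : incr k x = (g (x + k.+1%:R^-1)).1 - (g x).1.
  rewrite /incr; move: k.+1%:R^-1 kb k0 => c kb k0.
  by rewrite !clamp_id//; apply/andP; split; lra.
rewrite distrC /quot -[X in X * _]ger0_norm// -hnorm_scale//.
apply: le_trans (hnorm_dist _ _) _.
have -> : k.+1%:R *: incr k x - hvelocity g x =
    k.+1%:R *: (incr k x - k.+1%:R^-1 *: hvelocity g x).
  by rewrite [RHS]scalerBr scalerA mulfV// scale1r.
rewrite hnorm_scale// ger0_norm// mulrC -ler_pdivlMr// incrE.
have := dP x (x + k.+1%:R^-1) (lexx x); rewrite addrAC subrr add0r.
by apply => //; rewrite lerDl ltW.
Unshelve. all: by end_near. Qed.

End Curve.

(** The speed is integrated over the set [B] of interior points outside a null set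
    that contains all the times at which the curve is not differentiable or not
    horizontal: there it is measurable, and dropping the other times only
    decreases the length. *)
Lemma hdist_le_sf_length g a b : a <= b -> horizontal a b g ->
  ((hdist N (g a) (g b))%:E <= sf_length (fun z => N (z, 0%R)) a b g)%E.
Proof.
move=> ab [gac [A [mA A0 Abad]]].
have aeF := ae_filter_ringOfSetsType mu.
pose B := `]a, b[ `\` A.
have mB : measurable B by exact: measurableD.
have hor x : B x -> a < x < b /\ horizontal_at g x.
  move=> [xab xA]; have xab' : a < x < b by move: xab; rewrite /= in_itv.
  split => //; apply: contrapT => bad; apply: xA; apply: Abad => /= h.
  by apply: bad; apply: h; have /andP[? ?] := xab'; rewrite !ltW.
pose F x := N (hvelocity g x, 0).
have F0 x : 0 <= F x by exact: hnorm_ge0.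
have mF : measurable_fun B F.
  apply: (speed_measurable ab gac) => // x /hor[xab [dg _ _]]; split => //.
have BF : (\int[mu]_(x in B) (F x)%:E <= sf_length (fun z => N (z, 0%R)) a b g)%E.
  rewrite /sf_length integral_mkcond [leRHS]integral_mkcond.
  apply: ge0_le_integral_any => x; rewrite !patchE.
    by case: ifP => // _; rewrite lee_fin.
  case: ifPn => [|_]; last by case: ifP => // _; rewrite lee_fin (hnorm_ge0 hN).
  rewrite inE => /hor[/andP[ax xb] _]; rewrite ifT//.
  by rewrite inE /= in_itv /= !ltW.
have [fin|inf] := ltP (\int[mu]_(x in B) (F x)%:E)%E +oo%E; last first.
  by rewrite (le_trans _ BF)// (le_trans _ inf)// leey.
have [H [Hmono Hle Hae]] := integral_primitive B F mB mF F0 fin.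
apply: le_trans BF; apply: le_trans (Hle a b); rewrite lee_fin.
apply: hdist_le_increment => //.
have aeA : {ae mu, forall x, ~ A x} by exists A; split => // x /= /contrapT.
have ae3 : {ae mu, forall x, x <> a /\ x <> b /\ ~ A x}.
  by apply: filterI (ae_neq a) _; apply: filterI (ae_neq b) aeA.
apply: filterS2 ae3 Hae => x [xa [xb xA]] HB /andP[ax bx].
have Bx : B x.
  by split => //; rewrite /= in_itv /= !lt_neqAle ax bx !andbT eq_sym; apply/andP; split; apply/eqP.
have [_ hx] := hor x Bx; have [dH HE] := HB Bx; split => //.
Qed.

End Lower.

(** * Short polygons along a geodesic *)

Section Upper.
Context {R : realType} {n : nat} {N : heis R n -> R}.
Hypotheses (hn : (1 <= n)%N) (hN : homogeneous_norm N).
Implicit Types (z w : 'cV[R]_(n + n)) (p q : heis R n).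

Lemma polygon_cat p zs ws : polygon p (zs ++ ws) = polygon (polygon p zs) ws.
Proof. exact: foldl_cat. Qed.

Lemma polygon_bend p z w : polygon p [:: z; w; - z; - w] = hmul p (bend z w).
Proof. by rewrite /polygon /bend /= !hmulA. Qed.

(** A symplectic pair of basis vectors, both scaled like the square root of the height,
    spans the required parallelogram; the sign of the height is put on one of
    them. *)
Lemma vertical_bend : exists2 C : R, 0 <= C & forall T : R, exists z w,
  bend z w = (0, T) /\ N (z, 0) + N (w, 0) <= C * Num.sqrt `|T|.
Proof.
pose i0 : 'I_n := Ordinal hn.
pose ez : 'cV[R]_(n + n) := delta_mx (rshift n i0) 0.
pose ew : 'cV[R]_(n + n) := delta_mx (lshift n i0) 0.
have ezw : omega ez ew = 1.
  rewrite omegaE (bigD1 i0)//= big1 => [|i ii0].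
    by rewrite !mxE !eqxx eq_rlshift eq_lrshift mulr1 mulr0 subr0 addr0.
  by rewrite !mxE !eq_rshift !eq_lshift !eq_rlshift !eq_lrshift (negbTE ii0) !mul0r subr0.
exists (N (ez, 0) + N (ew, 0)); first by rewrite addr_ge0// (hnorm_ge0 hN).
move=> T; pose r := Num.sqrt `|T| / 2.
have r0 : 0 <= r by rewrite divr_ge0// sqrtr_ge0.
exists (r *: ez), ((Num.sg T * r) *: ew); split.
  rewrite bendE omegaZl omegaZr ezw; congr pair.
  have -> : 4 * (r * (Num.sg T * r * 1)) = Num.sg T * Num.sqrt `|T| ^+ 2.
    by rewrite /r; field.
  by rewrite sqr_sqrtr// -numEsg.
rewrite !(hnorm_scale hN) (ger0_norm r0) normrM (ger0_norm r0).
have sg1 : `|Num.sg T| <= 1 by rewrite normr_sg; case: (T != 0).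
have h1 : `|Num.sg T| * r * N (ew, 0) <= r * N (ew, 0).
  by rewrite ler_wpM2r ?(hnorm_ge0 hN)// ler_piMl.
have h2 : r <= Num.sqrt `|T| by have := sqrtr_ge0 `|T|; rewrite /r; lra.
have h3 := ler_wpM2r (addr_ge0 (hnorm_ge0 hN (ez, 0)) (hnorm_ge0 hN (ew, 0))) h2.
by move: h1 h3; lra.
Qed.

(** Cut the geodesic into [m + 1] steps of equal length [L / (m + 1)]. The horizontal
    parts of the steps have at most that norm, and the areas are of order
    [(L / (m + 1)) ^ 2], so that their sum is of order [1 / (m + 1)]. The development
    of the chain has length at most [L] and a short loop closes the gap to
    [g s2]. *)
Lemma geodesic_sf_short (g : R -> heis R n) (s1 s2 : R) :
    (forall s t, hdist N (g s) (g t) = `|s - t|) ->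
  forall e : R, 0 < e -> exists zs, polygon (g s1) zs = g s2 /\
    \sum_(z <- zs) N (z, 0) <= `|s1 - s2| + e.
Proof.
move=> geo e e0.
have [C C0 CP] := vertical_bend.
have N1 : 0 < N (0, 1) := hnorm_vertical_gt0 hN.
set L := `|s1 - s2|.
have L0 : 0 <= L by exact: normr_ge0.
(* more than [Q / e ^ 2] sides make the closing loop shorter than [e] *)
pose Q := 4 * L ^+ 2 * (2 * C) ^+ 2 / N (0, 1) ^+ 2.
have Q0 : 0 <= Q by rewrite divr_ge0 ?sqr_ge0// mulr_ge0 ?sqr_ge0// mulr_ge0 ?sqr_ge0.
pose m := Num.trunc (Q / e ^+ 2).
have mQ : Q / e ^+ 2 < m.+1%:R.
  by rewrite -truncn_lt_nat// divr_ge0// sqr_ge0.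
have m0 : 0 < m.+1%:R :> R by [].
pose t := subdivision s1 s2 m.
have t0 : t 0%N = s1 by exact: subdivision0.
have tm : t m.+1 = s2 by exact: subdivision_last.
have step i : N ((g (t i.+1)).1 - (g (t i)).1, area (g (t i)) (g (t i.+1))) =
    L / m.+1%:R.
  rewrite -hmulVE -[LHS]/(hdist N _ _) geo distrC subdivisionB normrM.
  by rewrite normfV distrC (ger0_norm (ltW m0)).
pose c := g \o t.
pose T := chain_area c m.+1.
have T_le : `|T| * N (0, 1) ^+ 2 <= 4 * L ^+ 2 / m.+1%:R.
  apply: le_trans (ler_wpM2r (sqr_ge0 _) (ler_norm_sum _ _ _)) _.
  rewrite mulr_suml.
  have -> : 4 * L ^+ 2 / m.+1%:R = \sum_(i < m.+1) 4 * (L / m.+1%:R) ^+ 2.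
    rewrite sumr_const card_ord -[RHS]mulr_natr.
    by field; rewrite gt_eqF.
  apply: ler_sum => i _; rewrite -(step i).
  exact: vertical_le_hnorm.
have [z [w [zwT zw_le]]] := CP T.
exists ([seq (c i.+1).1 - (c i).1 | i <- iota 0 m.+1] ++ [:: z; w; - z; - w]).
split.
  have -> : g s1 = c 0%N by rewrite /c /= t0.
  rewrite polygon_cat -develop_polygon polygon_bend zwT develop_correct.
  by rewrite /c /= tm.
have loop_len : \sum_(v <- [:: z; w; - z; - w]) N (v, 0) = 2 * (N (z, 0) + N (w, 0)).
  by rewrite !big_cons big_nil !(hnorm_opp hN); ring.
rewrite big_cat; apply: lerD.
  rewrite big_map -[iota 0 m.+1]/(index_iota 0 m.+1) big_mkord.
  apply: (@le_trans _ _ (\sum_(i < m.+1) L / m.+1%:R)).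
    by apply: ler_sum => i _; rewrite -(step i); exact: hnorm_horizontal_le.
  by rewrite sumr_const card_ord -[leLHS]mulr_natr divfK// gt_eqF.
rewrite -[leLHS]/(\sum_(v <- [:: z; w; - z; - w]) N (v, 0)) loop_len.
apply: (@le_trans _ _ (2 * C * Num.sqrt `|T|)); first by move: zw_le; lra.
have C20 : 0 <= 2 * C by rewrite mulr_ge0.
rewrite -ler_sqr ?nnegrE ?mulr_ge0 ?sqrtr_ge0 ?(ltW e0)//.
rewrite exprMn sqr_sqrtr//.
have e2 : 0 < e ^+ 2 by rewrite exprn_gt0.
have N12 : 0 < N (0, 1) ^+ 2 by rewrite exprn_gt0.
have T_le' : `|T| <= 4 * L ^+ 2 / m.+1%:R / N (0, 1) ^+ 2 by rewrite ler_pdivlMr.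
apply: le_trans (ler_wpM2l (sqr_ge0 _) T_le') _.
have -> : (2 * C) ^+ 2 * (4 * L ^+ 2 / m.+1%:R / N (0, 1) ^+ 2) = Q / m.+1%:R.
  by rewrite /Q; field; rewrite !gt_eqF.
rewrite ler_pdivrMr// mulrC -ler_pdivrMr//.
exact: ltW.
Qed.

End Upper.

Theorem proposition3p18 (R : realType) (n : nat) (hn : (1 <= n)%N)
    (N : heis R n -> R) (hN : homogeneous_norm N) :
  geodesic_linearity (sf_dist (fun z : 'cV[R]_(n + n) => N (z, 0))) ->
  geodesic_linearity (hdist N).
Proof.
move=> sf_linear g geo; apply: sf_linear => s1 s2.
rewrite /sf_dist; set S := (X in ereal_inf X).
suff -> : ereal_inf S = `|s1 - s2|%:E by [].
apply/eqP; rewrite eq_le; apply/andP; split.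
- apply/lee_addgt0Pr => e e0.
  have [zs [zsE zs_le]] := geodesic_sf_short hn hN g s1 s2 geo e e0.
  have nrm0 z : 0 <= N (z, 0) by exact: (hnorm_ge0 hN).
  have [a [b [h [ab hor h1 h2 len]]]] := polygon_horizontal nrm0 (g s1) zs.
  apply: (@le_trans _ _ (\sum_(z <- zs) N (z, 0))%:E); last by rewrite -EFinD lee_fin.
  apply: ereal_inf_lbound; exists a, b, h; split => //.
  by rewrite h2.
- apply/ereal_infP => _ [a [b [h [ab hor h1 h2 ->]]]].
  rewrite -geo -h1 -h2; exact: hdist_le_sf_length.
Qed.
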